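(* Let $M=(E,\mathcal{B})$ be a matroid of rank $r$ on $n$ elements, and let $u:=\dim(U(M))$. Then $$\ln \#\mathcal{D}(M)\leq u\ln\left(\binom{n}{r}n^4/u\right).$$
   Context: For a matroid $M=(E,\mathcal{B})$ of rank $r$ and $\nu:\mathcal{B}\to\mathbb{R}$, let $\overline{\nu}:\binom{E}{r}\to\mathbb{R}\cup\{\infty\}$ extend $\nu$ by $\infty$ outside $\mathcal{B}$. $\nu$ is a valuation of $M$ if for all $B,B'\in\binom{E}{r}$ and $e\in B\setminus B'$ there is $f\in B'\setminus B$ with $\overline{\nu}(B)+\overline{\nu}(B')\geq\overline{\nu}(B-e+f)+\overline{\nu}(B'+e-f)$; $\mathscr{D}(M)\subseteq\mathbb{R}^{\mathcal{B}}$ is the set of valuations. Let $Z(r,E)$ be the set of triples $(S,ab,cd)$ with $S\in\binom{E}{r-2}$ and $a,b,c,d\in E\setminus S$ distinct; $Sab:=S\cup\{a,b\}$ etc. Put $[\overline{\nu}]:=\{(S,ab,cd)\in Z(r,E):\overline{\nu}(Sac)+\overline{\nu}(Sbd)=\overline{\nu}(Sad)+\overline{\nu}(Sbc)\}$; valuations $\nu,\nu'$ are combinatorially equivalent if $[\overline{\nu}]=[\overline{\nu'}]$. The cells of the fan $\mathcal{D}(M)$ are the closures of the combinatorial equivalence classes of valuations, and $\#\mathcal{D}(M)$ is the number of cells. Let $Z(M):=\{(S,ab,cd)\in Z(r,E): Sac,Sbd,Sad,Sbc\in\mathcal{B}\}$ and $Z_0(M):=\{(S,ab,cd)\in Z(M):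 Sab\notin\mathcal{B}\text{ or }Scd\notin\mathcal{B}\}$. For $Z\subseteq Z(M)$, $L(Z)$ is the linear subspace of $\nu\in\mathbb{R}^{\binom{E}{r}}$ with $\nu(Sac)+\nu(Sbd)=\nu(Sad)+\nu(Sbc)$ for all $(S,ab,cd)\in Z$ and $\nu(B)=0$ for all $B\notin\mathcal{B}$. $U(M):=L(Z_0(M))$. *)

(* Defs.v *)
From HB Require Import structures.
From mathcomp Require Import all_boot all_order all_algebra.
From mathcomp Require Import finmap.
From mathcomp Require Import all_classical all_reals all_analysis.

Set Implicit Arguments.
Unset Strict Implicit.
Unset Printing Implicit Defensive.

Import Order.TTheory GRing.Theory Num.Theory.
Import numFieldNormedType.Exports.

Local Open Scope ring_scope.

(* Matroids of rank [r] on the ground set [E], given by their bases. *)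
Record matroid (E : finType) (r : nat) := Matroid {
  bases : {set {set E}};
  bases_neq0 : bases != finset.set0;
  card_bases : forall B, B \in bases -> #|B| = r;
  bases_exchange : forall B B' : {set E}, B \in bases -> B' \in bases ->
    forall e, e \in B :\: B' ->
      exists2 f, f \in B' :\: B & f |: (B :\ e) \in bases
}.

(* A triple (S, ab, cd) is coded as (S, (a, b), (c, d)).  The conditions imposed
   on triples below are invariant under swapping a with b, swapping c with d,
   and swapping ab with cd, so recording ordered instead of unordered pairs
   changes neither the combinatorial equivalence of valuations nor [U]. *)
Definition triple (E : finType) : Type := {set E} * (E * E) * (E * E).
HB.instance Definition _ (E : finType) := Finite.on (triple E).

Section Triples.
Context {E : finType}.

(* [#|S0| + 2 == r] says |S| = r - 2 without truncation: for r < 2 there are no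
   triples. *)
Definition triples (r : nat) : {set triple E} :=
  [set t : triple E | let: (S0, (a, b), (c, d)) := t in
    [&& (#|S0| + 2 == r)%N, uniq [:: a; b; c; d]
      & all (fun x => x \notin S0) [:: a; b; c; d]]]%SET.

Definition add2 (S0 : {set E}) (x y : E) : {set E} := x |: (y |: S0).

Context {r : nat} (M : matroid E r).

Definition triplesM : {set triple E} :=
  [set t in triples r | let: (S0, (a, b), (c, d)) := t in
    [&& add2 S0 a c \in bases M, add2 S0 b d \in bases M,
        add2 S0 a d \in bases M & add2 S0 b c \in bases M]]%SET.

Definition triplesM0 : {set triple E} :=
  [set t in triplesM | let: (S0, (a, b), (c, d)) := t in
    (add2 S0 a b \notin bases M) || (add2 S0 c d \notin bases M)]%SET.

End Triples.

Definition mbasis (E : finType) (r : nat) (M : matroid E r) : Type :=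
  {B : {set E} | B \in bases M}.

Section Dressian.
Context {R : realType} {E : finType} {r : nat} (M : matroid E r).

(* R^B, with the product topology. *)
Definition weight : Type := {ptws mbasis M -> R}.
HB.instance Definition _ := Topological.on weight.

Local Open Scope ereal_scope.

(* Only used at subsets [B] of cardinality [r]. *)
Definition nubar (nu : weight) (B : {set E}) : \bar R :=
  if insub B is Some b then (nu b)%:E else +oo.

Definition valuation (nu : weight) : Prop :=
  forall B B' : {set E}, #|B| = r -> #|B'| = r ->
  forall e, e \in B :\: B' ->
    exists2 f, f \in B' :\: B
      & nubar nu B + nubar nu B' >=
        nubar nu (f |: (B :\ e)) + nubar nu (e |: (B' :\ f)).

Definition tight_triples (nu : weight) : {set triple E} :=
  [set t in triples r | let: (S0, (a, b), (c, d)) := t in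
    nubar nu (add2 S0 a c) + nubar nu (add2 S0 b d) ==
    nubar nu (add2 S0 a d) + nubar nu (add2 S0 b c)]%SET.

Local Open Scope classical_set_scope.

Definition comb_class (nu : weight) : set weight :=
  [set nu' | valuation nu' /\ tight_triples nu' = tight_triples nu].

Definition dressian_cells : set (set weight) :=
  [set closure (comb_class nu) | nu in [set nu | valuation nu]].

End Dressian.

Arguments dressian_cells R {E r} M.

Section LinearSpaces.
Context {R : realType} {E : finType} {r : nat} (M : matroid E r).

Definition rsubset : Type := {B : {set E} | #|B| == r}.
HB.instance Definition _ := Finite.on rsubset.

Definition rweight : Type := {ffun rsubset -> R^o}.
HB.instance Definition _ := Vector.on rweight.

(* Value at [B]; the default 0 is irrelevant, since [B] always has
   cardinality [r] when this is used for triples in [triples r]. *)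
Definition rval (B : {set E}) (nu : rweight) : R^o :=
  if insub B is Some b then nu b else 0.

Definition triple_form (t : triple E) (nu : rweight) : R^o :=
  let: (S0, (a, b), (c, d)) := t in
  rval (add2 S0 a c) nu + rval (add2 S0 b d) nu
  - (rval (add2 S0 a d) nu + rval (add2 S0 b c) nu).

(* L(Z), as an intersection of kernels; see [mem_slack_space]. *)
Definition slack_space (Z : {set triple E}) : {vspace rweight} :=
  (\bigcap_(t in Z) lker (linfun (triple_form t)) :&:
   \bigcap_(B : {set E} | (#|B| == r) && (B \notin bases M))
      lker (linfun (rval B)))%VS.

Lemma rval_is_linear B : linear (rval B).
Proof.
move=> k u v; rewrite /rval; case: insubP => [b _ _|_]; first by rewrite !ffunE.
by rewrite scaler0 addr0.
Qed.

HB.instance Definition _ B :=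
  GRing.isLinear.Build R rweight R^o _ (rval B) (rval_is_linear B).

Lemma triple_form_is_linear t : linear (triple_form t).
Proof.
case: t => [[S0 [a b]] [c d]] k u v; rewrite /triple_form !rval_is_linear.
set A := rval _ u; set A' := rval _ v.
set B := rval _ u; set B' := rval _ v.
set C := rval _ u; set C' := rval _ v.
set D := rval _ u; set D' := rval _ v.
rewrite (addrACA (k *: A)) (addrACA (k *: C)) -!(scalerDr k) opprD.
by rewrite (addrACA (k *: _)) -(scalerBr k).
Qed.

HB.instance Definition _ t :=
  GRing.isLinear.Build R rweight R^o _ (triple_form t)
    (triple_form_is_linear t).

Lemma mem_slack_space (Z : {set triple E}) (nu : rweight) :
  reflect
    ((forall S0 a b c d, (S0, (a, b), (c, d)) \in Z ->
        rval (add2 S0 a c) nu + rval (add2 S0 b d) nu =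
        rval (add2 S0 a d) nu + rval (add2 S0 b c) nu) /\
     (forall B : rsubset, val B \notin bases M -> nu B = 0))
    (nu \in slack_space Z).
Proof.
rewrite memv_cap; apply: (iffP andP) => -[].
  move=> /subv_bigcapP h1 /subv_bigcapP h2; split.
    move=> S0 a b c d tZ; have := h1 _ tZ.
    by rewrite -memvE memv_ker lfunE /= subr_eq0 => /eqP.
  move=> B BM; have := h2 (val B); rewrite (valP B) BM => /(_ isT).
  by rewrite -memvE memv_ker lfunE /= /rval valK => /eqP.
move=> h1 h2; split; apply/subv_bigcapP.
  move=> [[S0 [a b]] [c d]] tZ; rewrite -memvE memv_ker lfunE /= subr_eq0.
  by apply/eqP/h1.
move=> B /andP[Br BM]; rewrite -memvE memv_ker lfunE /= /rval.
by rewrite insubT /=; apply/eqP/h2.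
Qed.

Definition U : {vspace rweight} := slack_space (triplesM0 M).

End LinearSpaces.

Arguments U R {E r} M.

(* Main.v *)
(** A valuation, extended by 0 outside the bases, lies in U(M), and its
    combinatorial class is recovered from L(T), where T is the set of those
    triples of Z(M) that are tight for it.  L(T) is cut out of U(M) by at most
    u = dim U(M) of the triples of T, so the number of cells is at most the
    number of subsets of Z(M) of size at most u.  With m = #Z(M) the latter is
    at most (1 + x)^m / x^u for every x in ]0, 1]; the bound follows from
    4 m <= C(n, r) n^4 by choosing x = e u / (C(n, r) n^4). *)

Require Import Defs.
From mathcomp Require Import all_boot all_order all_algebra.
From mathcomp Require Import finmap.
From mathcomp Require Import all_classical all_reals all_analysis.
From mathcomp Require Import zify lra.

Import Order.TTheory GRing.Theory Num.Theory.

Local Open Scope ring_scope.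

(** * Counting small subsets, independent equations and triples *)

(** The power expands into the sum of x ^ #|J| over all J inside A, and x ^ u <= x ^ #|J| when #|J|
    <= u, because x <= 1. *)
Lemma card_small_subsets (R : realType) (T : finType) (A : {set T}) (u : nat)
    (x : R) : 0 <= x <= 1 ->
  #|[set B : {set T} | (B \subset A) && (#|B| <= u)%N]%SET|%:R * x ^+ u
    <= (1 + x) ^+ #|A|.
Proof.
move=> /andP[x0 x1]; set S := [set B | _]%SET.
have -> : (1 + x) ^+ #|A| =
    \sum_(J : {set T}) \prod_(i in J) (if i \in A then x else 0).
  rewrite -prodr_const big_mkcond /=.
  under eq_bigr => i _ do
    have -> : (if i \in A then 1 + x else 1) = (if i \in A then x else 0) + 1
      by case: ifP => _; rewrite ?add0r // addrC.
  rewrite bigA_distr; apply: eq_bigr => J _; exact/esym/big_mkcond.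
rewrite mulr_natl -sumr_const big_mkcond /=.
apply: ler_sum => J _; case: ifP => [|_]; last first.
  by apply: prodr_ge0 => i _; case: ifP.
rewrite inE => /andP[/fintype.subsetP JA Ju].
rewrite (eq_bigr (fun=> x)) => [|i /JA -> //].
by rewrite prodr_const ler_wiXn2l.
Qed.

(** Greedy choice: t is kept only if [F t] cuts the current intersection properly, and each kept t
    lowers the dimension by at least one. *)
Lemma subset_bigcapv (K : fieldType) (V : vectType K) (T : finType)
    (F : T -> {vspace V}) (W : {vspace V}) (Z : {set T}) :
  exists2 Z' : {set T}, Z' \subset Z &
    (W :&: \bigcap_(t in Z') F t = W :&: \bigcap_(t in Z) F t)%VS /\
    (#|Z'| + \dim (W :&: \bigcap_(t in Z) F t) <= \dim W)%N.
Proof.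
elim: {Z}_.+1 {-2}Z (ltnSn #|Z|) => // n IH Z; rewrite ltnS => Zn.
have [->|[t tZ]] := set_0Vmem Z.
  exists finset.set0 => //; split => //.
  by rewrite big_set0 capvf cards0.
have [|Z' Z'Z [eqZ dimZ]] := IH (Z :\ t)%SET.
  by rewrite (cardsD1 t) tZ in Zn.
set X := (W :&: \bigcap_(s in Z :\ t) F s)%VS in eqZ dimZ.
have XE : (W :&: \bigcap_(s in Z) F s = F t :&: X)%VS.
  by rewrite (big_setD1 t) //= capvA (capvC W) -capvA.
rewrite XE; have [XF|XF] := boolP (X <= F t)%VS.
  exists Z'; first exact: fintype.subset_trans Z'Z (subD1set _ _).
  by rewrite (capv_idPr XF).
have tZ' : t \notin Z'
  by apply: contraTN (tZ) => /(fintype.subsetP Z'Z); rewrite !inE eqxx.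
exists (t |: Z')%SET; last split.
- rewrite finset.subUset finset.sub1set tZ /=.
  exact: fintype.subset_trans Z'Z (subD1set _ _).
- by rewrite big_setU1 //= capvA (capvC W) -capvA eqZ.
rewrite cardsU1 tZ' add1n addSn -addnS (leq_trans _ dimZ) // leq_add2l.
rewrite ltnNge; apply: contra XF => dimX.
have /eqP <- : (F t :&: X == X)%VS by rewrite eqEdim capvSr.
exact: capvSl.
Qed.

(* (S, ab, cd) is determined by (Sac, ab, cd), where a is in Sac and b is not:
   this leaves C(n, r) * r (n - r) * n^2 possibilities, and 4 r (n - r) <= n^2. *)
Lemma card_triples (E : finType) (r : nat) :
  (4 * #|@triples E r| <= 'C(#|E|, r) * #|E| ^ 4)%N.
Proof.
set n := #|E|.
pose g (t : triple E) : triple E :=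
  let: (S0, (a, b), (c, d)) := t in (add2 S0 a c, (a, b), (c, d)).
have g_inj : {in triples r &, injective g}.
  have gK (S0 : {set E}) a b c d : (S0, (a, b), (c, d)) \in triples r ->
      ((add2 S0 a c :\ a) :\ c = S0)%SET.
    rewrite inE /= !inE !negb_or.
    move=> /and5P[_ /and3P[/and3P[_ ac _] _ _] aS _ /and3P[cS _ _]].
    by rewrite /add2 !setU1K // !inE negb_or ac.
  move=> [[S0 [a b]] [c d]] [[S1 [a' b']] [c' d']].
  move=> /gK tK /gK tK' [eqS ea eb ec ed].
  by subst a' b' c' d'; rewrite -tK -tK' eqS.
pose P := [set t : triple E |
  [&& #|t.1.1| == r, t.1.2.1 \in t.1.1 & t.1.2.2 \notin t.1.1]]%SET.
have gP : (g @: triples r)%SET \subset P.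
  apply/fintype.subsetP => _ /imsetP[[[S0 [a b]] [c d]] + ->].
  rewrite /g !inE /= !inE !negb_or eqxx /=.
  move=> /and5P[/eqP <- /and3P[/and3P[ab ac ad] /andP[bc bd] _]].
  move=> aS bS /and3P[cS _ _].
  rewrite [b == a]eq_sym ab bc bS andbT /add2 !cardsU1 !inE negb_or ac aS cS.
  by rewrite andbT !add1n addn2.
rewrite -(card_in_imset g_inj).
(* The final estimate uses r + (n - r) = n, which truncated subtraction breaks for r > n; in that
   case no set has r elements. *)
have [nr|rn] := ltnP n r.
  suff -> : #|(g @: triples r)%SET| = 0%N by [].
  apply/eqP; rewrite cards_eq0 -finset.subset0.
  apply: (fintype.subset_trans gP).
  apply/fintype.subsetP => t; rewrite inE => /andP[/eqP tr _].
  by have := max_card t.1.1; rewrite tr leqNgt nr.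
apply: leq_trans (_ : 4 * #|P| <= _)%N.
  by rewrite leq_mul2l subset_leq_card.
have -> : (#|P| = \sum_(t in P) 1)%N by rewrite sum1_card.
pose Br := [set B : {set E} | #|B| == r]%SET.
rewrite (partition_big (fun t => t.1.1) (mem Br)) /=; last first.
  by move=> t; rewrite !inE => /andP[].
apply: (@leq_trans (4 * \sum_(B in Br) (r * (n - r) * (n * n)))).
  rewrite leq_mul2l; apply/orP; right; apply: leq_sum => B.
  rewrite inE => /eqP cardB.
  have -> : (n - r)%N = #|~: B|%SET by rewrite cardsCs finset.setCK cardB.
  rewrite -{1}cardB -cardsX -/n -[n]cardsT -!cardsX.
  rewrite sum1_card.
  pose h (p : (E * E) * (E * E)) : triple E := (B, p.1, p.2).
  apply: leq_trans (leq_imset_card h _).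
  apply/subset_leq_card/fintype.subsetP => -[[B' [a b]] [c d]].
  rewrite unfold_in !inE /= => /andP[/and3P[_ aB bB] /eqP eB]; subst B'.
  by apply/imsetP; exists ((a, b), (c, d)); rewrite // !inE /= aB bB.
rewrite sum_nat_const card_draws -/n mulnCA leq_mul2l.
apply/orP; right; rewrite mulnA (expnD n 2 2) -[(n * n)%N]/(n ^ 2)%N.
by rewrite leq_mul2r -[X in (_ <= X ^ 2)%N](subnKC rn) nat_AGM2 orbT.
Qed.

(** * Tight triples as linear equations *)

Section Valuations.
Context {R : realType} {E : finType} {r : nat} (M : matroid E r).

Lemma nubar_oo (nu : @weight R E r M) (B : {set E}) :
  B \notin bases M -> nubar nu B = +oo%E.
Proof. by move=> BM; rewrite /nubar insubF //; apply/negbTE. Qed.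

(** Carries a point of R^B into the space where L(Z) and U(M) live; off the bases, 0 replaces the
    value +oo of [nubar]. *)
Definition zero_ext (nu : @weight R E r M) : @rweight R E r :=
  [ffun B : @rsubset E r =>
     (if insub (val B) is Some b then nu b else 0) : R^o].

Lemma nubarE (nu : @weight R E r M) (B : {set E}) :
  B \in bases M -> nubar nu B = (rval B (zero_ext nu))%:E.
Proof.
move=> BM; have Br : #|B| == r by apply/eqP/(card_bases BM).
by rewrite /nubar /rval insubT insubT /= ffunE /= insubT.
Qed.

Lemma mem_tight_triples (nu : @weight R E r M) S0 a b c d :
  (S0, (a, b), (c, d)) \in triplesM M ->
  ((S0, (a, b), (c, d)) \in tight_triples nu) =
  (rval (add2 S0 a c) (zero_ext nu) + rval (add2 S0 b d) (zero_ext nu) ==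
   rval (add2 S0 a d) (zero_ext nu) + rval (add2 S0 b c) (zero_ext nu)).
Proof.
rewrite inE => /andP[tr /and4P[ac bd ad bc]].
by rewrite inE tr !nubarE.
Qed.

Lemma zero_ext_slack_space (nu : @weight R E r M) (Z : {set triple E}) :
  Z \subset triplesM M ->
  (zero_ext nu \in slack_space M Z) = (Z \subset tight_triples nu).
Proof.
move=> /fintype.subsetP ZM.
apply/mem_slack_space/fintype.subsetP => [[hZ _]|hZ].
  move=> [[S0 [a b]] [c d]] tZ; rewrite mem_tight_triples ?ZM //.
  exact/eqP/hZ.
split=> [S0 a b c d tZ|B BM].
  by apply/eqP; rewrite -mem_tight_triples ?ZM ?hZ.
by rewrite ffunE insubF //; apply/negbTE.
Qed.

(** Some term is +oo, so the triple is tight exactly when both sides are +oo, and this depends on M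
    alone. *)
Lemma tight_triples_notin (nu nu' : @weight R E r M) t :
  t \notin triplesM M ->
  (t \in tight_triples nu) = (t \in tight_triples nu').
Proof.
move: t => [[S0 [a b]] [c d]]; rewrite inE => tM.
rewrite 2![_ \in tight_triples _]inE; move: tM; case: (_ \in triples r) => //=.
have nuE nu0 B : nubar nu0 B =
  if B \in bases M then (rval B (zero_ext nu0))%:E else +oo%E.
  by case: ifPn => ?; [exact: nubarE | exact: nubar_oo].
rewrite !nuE.
by do 4 case: ifP => _ //=.
Qed.

(** Exchanging a between Sac and Sbd leaves f = b or f = d. The choice f = b is the claim; f = d
    produces Scd and Sab, one of which is not a basis, so that +oo would be at most a finite sum. *)
Lemma valuation_le (nu : @weight R E r M) S0 a b c d : valuation nu ->
  (S0, (a, b), (c, d)) \in triplesM0 M ->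
  (nubar nu (add2 S0 a d) + nubar nu (add2 S0 b c) <=
   nubar nu (add2 S0 a c) + nubar nu (add2 S0 b d))%E.
Proof.
move=> nuV; rewrite inE => /andP[+ abcd].
rewrite inE => /andP[+ /and4P[ac bd ad bc]].
rewrite inE /= !inE !negb_or => /and3P[_].
move=> /and3P[/and3P[nab nac nad] /andP[nbc nbd] _] /and5P[aS bS cS dS _].
have [|f] := nuV _ _ (card_bases ac) (card_bases bd) a.
  by rewrite !inE eqxx /= !negb_or nab nad aS.
rewrite !inE !negb_or => /andP[/and3P[fa fc fS]].
move=> /or3P[/eqP ef|/eqP ef|fS']; last first.
- by rewrite fS' in fS.
- have -> : (f |: (add2 S0 a c :\ a) = add2 S0 c d)%SET.
    by rewrite ef /add2 setU1K ?inE ?negb_or ?nac // finset.setUCA.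
  have -> : (a |: (add2 S0 b d :\ f) = add2 S0 a b)%SET.
    rewrite ef /add2 (finset.setUCA [set b]%SET) setU1K //.
    by rewrite !inE negb_or eq_sym nbd.
  rewrite (nubarE _ _ ac) (nubarE _ _ bd).
  case/orP: abcd => /(nubar_oo nu) ->.
    by rewrite addey ?leye_eq // /nubar; case: insub.
  by rewrite addye ?leye_eq // /nubar; case: insub.
- have -> : (f |: (add2 S0 a c :\ a) = add2 S0 b c)%SET.
    by rewrite ef /add2 setU1K ?inE ?negb_or ?nac.
  have -> : (a |: (add2 S0 b d :\ f) = add2 S0 a d)%SET.
    by rewrite ef /add2 setU1K ?inE ?negb_or ?nbd.
  by rewrite addeC.
Qed.

Lemma triplesM0_swap S0 a b c d : (S0, (a, b), (c, d)) \in triplesM0 M ->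
  (S0, (a, b), (d, c)) \in triplesM0 M.
Proof.
rewrite !inE /= !inE !negb_or.
rewrite /add2 (finset.setUCA [set d]%SET) [d == c]eq_sym.
by do ! [case: (_ == _) => //= | case: (_ \in _) => //=].
Qed.

(** Exchanging c and d turns the inequality of [valuation_le] into its converse. *)
Lemma triplesM0_tight (nu : @weight R E r M) : valuation nu ->
  triplesM0 M \subset tight_triples nu.
Proof.
move=> nuV; apply/fintype.subsetP => -[[S0 [a b]] [c d]] t0.
have := t0; rewrite inE => /andP[+ _]; rewrite inE => /andP[tr _].
by rewrite inE tr eq_le !valuation_le //; apply: triplesM0_swap.
Qed.

(** Each of the two extensions lies in the common space, hence satisfies the equations of the tight
    triples of the other. Outside Z(M) tightness does not depend on the valuation. *)
Lemma tight_triples_inj (nu nu' : @weight R E r M) :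
  slack_space M (triplesM M :&: tight_triples nu)%SET =
  slack_space M (triplesM M :&: tight_triples nu')%SET
    :> {vspace @rweight R E r} ->
  tight_triples nu = tight_triples nu'.
Proof.
move=> eqL.
have sub (mu mu' : @weight R E r M) :
    slack_space M (triplesM M :&: tight_triples mu)%SET =
    slack_space M (triplesM M :&: tight_triples mu')%SET
      :> {vspace @rweight R E r} ->
    triplesM M :&: tight_triples mu' \subset tight_triples mu.
  by move=> eqm; rewrite -zero_ext_slack_space ?finset.subsetIl // -eqm
    zero_ext_slack_space ?finset.subsetIl ?finset.subsetIr.
apply/finset.setP => t; have [tM|] := boolP (t \in triplesM M); last first.
  exact: tight_triples_notin.
apply/idP/idP => tn.
  by apply: (fintype.subsetP (sub _ _ (esym eqL))); rewrite inE tM.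
by apply: (fintype.subsetP (sub _ _ eqL)); rewrite inE tM.
Qed.

Lemma slack_spaceU (Z Z' : {set triple E}) :
  slack_space M (Z :|: Z')%SET =
  (slack_space M Z :&: \bigcap_(t in Z') lker (linfun (triple_form t)))%VS
    :> {vspace @rweight R E r}.
Proof.
have inP (Y : {set triple E}) (v : @rweight R E r) :
    reflect {in Y, forall t, v \in lker (linfun (triple_form t))}
      (v \in \bigcap_(t in Y) lker (linfun (triple_form t)))%VS.
  rewrite memvE; apply: (iffP subv_bigcapP) => vY t /vY; by rewrite memvE.
apply/vspaceP => v; rewrite /slack_space !memv_cap andbAC; congr (_ && _).
apply/inP/andP => [vZ|[/inP vZ /inP vZ'] t].
  by split; apply/inP => t tZ; apply: vZ; rewrite inE tZ ?orbT.
by rewrite inE => /orP[/vZ|/vZ'].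
Qed.

Lemma small_slack_space (nu : @weight R E r M) : valuation nu ->
  exists2 Z : {set triple E},
    (Z \subset triplesM M) && (#|Z| <= \dim (U R M))%N &
    slack_space M (triplesM0 M :|: Z)%SET =
    slack_space M (triplesM M :&: tight_triples nu)%SET
      :> {vspace @rweight R E r}.
Proof.
move=> nuV; set T := (triplesM M :&: tight_triples nu)%SET.
have [Z ZT [eqZ dimZ]] := subset_bigcapv _ _ _
  (fun t => lker (linfun (@triple_form R E r t))) (U R M) T.
exists Z.
  rewrite (leq_trans (leq_addr _ _) dimZ) andbT.
  exact: fintype.subset_trans ZT (finset.subsetIl _ _).
rewrite slack_spaceU eqZ -slack_spaceU; congr slack_space.
(* Z_0(M) is contained in T, so adjoining it to T changes nothing. *)
apply/finset.setUidPr; rewrite finset.subsetI triplesM0_tight // andbT.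
by apply/fintype.subsetP => t; rewrite inE => /andP[].
Qed.

(** * Counting the cells *)

Local Open Scope classical_set_scope.

(** Defined for every Z, and empty if no valuation fits, so that the cells lie in the image of a map
    on small sets of triples. *)
Definition cell_of (Z : {set triple E}) : set (@weight R E r M) :=
  closure [set nu | valuation nu /\
    slack_space M (triplesM M :&: tight_triples nu)%SET =
    slack_space M (triplesM0 M :|: Z)%SET :> {vspace @rweight R E r}].

Lemma dressian_cells_small : dressian_cells R M `<=`
  [set` [fset cell_of Z | Z in [set Z : {set triple E} |
      (Z \subset triplesM M) && (#|Z| <= \dim (U R M))%N]%SET]%fset].
Proof.
move=> _ [nu nuV <-]; have [Z Zs eqL] := small_slack_space _ nuV.
apply/imfsetP; exists Z; first by rewrite inE.
congr closure; apply/seteqP; split=> nu' [nuV' h]; split=> //.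
  by rewrite h eqL.
by apply: tight_triples_inj; rewrite h.
Qed.

(** [fset_set] is empty on infinite sets, so the bound has content only together with finiteness. *)
Lemma card_dressian_cells : finite_set (dressian_cells R M) /\
  (#|` fset_set (dressian_cells R M)|%fset <=
   #|[set Z : {set triple E} |
      (Z \subset triplesM M) && (#|Z| <= \dim (U R M))%N]%SET|)%N.
Proof.
have fin := sub_finite_set dressian_cells_small (finite_fset _).
split=> //; have := dressian_cells_small.
rewrite fset_set_sub ?set_fsetK //.
move=> /fsubset_leq_card /leq_trans; apply.
by apply: leq_trans (leq_imfset_card _ _ _) _; rewrite cardE.
Qed.

(** For n >= 2 this yields 4 u <= C(n, r) n^4, which keeps the chosen x below 1. *)
Lemma dimU_le : (\dim (U R M) <= 'C(#|E|, r))%N.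
Proof.
apply: leq_trans (dimvS (subvf _)) _; rewrite dimvf.
have -> : dim (@rweight R E r) = #|{: @rsubset E r}| by rewrite [LHS]muln1.
by rewrite card_sig -card_draws cardsE.
Qed.

End Valuations.

(** * Optimising x and concluding *)

(** Square exp(-1/2) >= 1 - 1/2. Together with 4 u <= N this gives e u / N <= 1. *)
Lemma expR1_le4 (R : realType) : expR 1 <= 4 :> R.
Proof.
have h : 2^-1 <= expR (- 2^-1) :> R.
  by apply: le_trans (expR_ge1Dx _); lra.
have : expR 1 * expR (- 2^-1) ^+ 2 = 1 :> R.
  by rewrite -expRM_natr mulNr mulVf // -expRD subrr expR0.
have := expR_gt0 (1 : R); set e := expR 1; set y := expR _ in h *.
move=> e0 ey; have : 4^-1 <= y ^+ 2 by nra.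
by rewrite -(ler_pM2l e0) ey; lra.
Qed.

(* With x = e u / N, the hypothesis gives
   K x ^ u <= (1 + x) ^ m <= e ^ (x m) <= e ^ u. *)
Lemma ln_count_le (R : realType) (K m u N : nat) :
  (forall x : R, 0 <= x <= 1 -> K%:R * x ^+ u <= (1 + x) ^+ m) ->
  (4 * m <= N)%N -> (4 * u <= N)%N ->
  ln (K%:R : R) <= u%:R * ln (N%:R / u%:R).
Proof.
move=> hK mN uN.
have [u0|u0] := posnP u.
  (* At x = 0 the hypothesis reads K <= 1, since 0 ^ 0 = 1. *)
  rewrite u0 mul0r; apply: ln_le0.
  by have := hK 0; rewrite u0 expr0 mulr1 lexx ler01 addr0 expr1n => /(_ isT).
have u0R : 0 < u%:R :> R by rewrite ltr0n.
have N0 : 0 < N%:R :> R by rewrite ltr0n; lia.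
have e0 : 0 < expR 1 :> R by exact: expR_gt0.
have e4 := expR1_le4 R.
have uNR : 4 * u%:R <= N%:R :> R by rewrite -natrM ler_nat.
have mNR : 4 * m%:R <= N%:R :> R by rewrite -natrM ler_nat.
have m0 : 0 <= m%:R :> R by rewrite ler0n.
set x : R := expR 1 * u%:R / N%:R.
have x0 : 0 < x by rewrite divr_gt0 ?mulr_gt0.
have x1 : x <= 1 by rewrite ler_pdivrMr // mul1r; nra.
have lnx : ln x = 1 - ln (N%:R / u%:R).
  rewrite /x -mulrA lnM ?posrE ?divr_gt0 // expRK; congr (_ + _).
  by rewrite -[u%:R / _]invrK invf_div lnV // posrE divr_gt0.
have [->|K0] := posnP K.
  (* Here ln 0 = 0 by convention, so N / u >= 1 must be checked. *)
  rewrite ln0 // mulr_ge0 ?ler0n // ln_ge0 // ler_pdivlMr // mul1r.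
  by nra.
have KR : 0 < K%:R :> R by rewrite ltr0n.
have xm : x * m%:R <= u%:R.
  rewrite /x mulrAC ler_pdivrMr // -mulrA mulrCA ler_pM2l //.
  by apply: le_trans mNR; rewrite ler_wpM2r.
have : K%:R * x ^+ u <= expR u%:R.
  apply: le_trans (hK _ _) _; first by rewrite x1 ltW.
  apply: (@le_trans _ _ (expR x ^+ m)).
    by rewrite lerXn2r ?nnegrE ?expR_ge1Dx ?expR_ge0 // addr_ge0 // ltW.
  by rewrite -expRM_natr ler_expR.
(* Taking logarithms gives ln K + u (1 - ln (N / u)) <= u, and u cancels. *)
rewrite -ler_ln ?posrE ?expR_gt0 ?mulr_gt0 ?exprn_gt0 //.
rewrite expRK lnM ?posrE ?exprn_gt0 // lnXn // lnx -mulr_natl.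
by lra.
Qed.

Theorem theorem5 (R : realType) (E : finType) (r n : nat) (M : matroid E r)
    (hn : #|E| = n) (u : nat) (hu : u = \dim (U R M)) :
  finite_set (dressian_cells R M) /\
  ln (#|` fset_set (dressian_cells R M)|%fset%:R : R) <=
    u%:R * ln ('C(n, r)%:R * n%:R ^+ 4 / u%:R).
Proof.
have [fin cardK] := card_dressian_cells (R := R) M.
split => //; move: cardK; rewrite -hu.
set K := #|` _|%fset; set S := [set Z | _]%SET => KS.
have hK (x : R) : 0 <= x <= 1 -> K%:R * x ^+ u <= (1 + x) ^+ #|triplesM M|.
  move=> x01; apply: le_trans (card_small_subsets R _ (triplesM M) u x x01).
  by rewrite ler_wpM2r ?ler_nat // exprn_ge0 //; case/andP: x01.
have mN : (4 * #|triplesM M| <= 'C(n, r) * n ^ 4)%N.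
  rewrite -hn; apply: leq_trans (card_triples E r).
  rewrite leq_mul2l; apply/orP; right; apply/subset_leq_card.
  by apply/fintype.subsetP => t; rewrite inE => /andP[].
have uC : (u <= 'C(n, r))%N by rewrite hu -hn dimU_le.
(* For n <= 1 the bound 4 u <= C(n, r) n^4 can fail. Then 4 m <= 1 forces m = 0, hence K <= 1, and
   it remains to see that the right-hand side is nonnegative. *)
have [n1|n2] := leqP n 1; last first.
  rewrite -natrX -natrM; apply: ln_count_le hK mN _.
  have n4 : (2 ^ 4 <= n ^ 4)%N by rewrite leq_exp2r.
  by rewrite mulnC leq_mul // (leq_trans _ n4).
have m0 : #|triplesM M| = 0%N.
  apply/eqP; rewrite -leqn0 -ltnS -(ltn_pmul2l (m := 4)) //.
  apply: leq_ltn_trans mN _.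
  by case: n n1 {hn uC} => [|[|//]] _; case: (r) => [|[|?]].
have K1 : ln (K%:R : R) <= 0.
  apply: ln_le0; have := hK 1; rewrite m0 expr0 expr1n mulr1; apply.
  by rewrite ler01 lexx.
apply: le_trans K1 _; have [->|u0] := posnP u; first by rewrite mul0r.
(* For n = 0 the logarithm is ln 0 = 0; for n = 1 its argument is C(1, r) / u >= 1. *)
case: n n1 uC {hn mN} => [|[|//]] _ uC.
  by rewrite expr0n mulr0 mul0r ln0 ?mulr0.
rewrite mulr_ge0 // ln_ge0 // expr1n mulr1.
by rewrite ler_pdivlMr ?ltr0n // mul1r ler_nat.
Qed.
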